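(* Let $E$ be a finite set and $\mathcal{L}$ a set of subsets of $E$ with $|\mathcal{L}|=n$, and suppose the toggle group $T(\mathcal{L})$ acts transitively on $\mathcal{L}$. If $T(\mathcal{L})$ contains a transposition, then $T(\mathcal{L})$ is the full symmetric group on $\mathcal{L}$ (so $T(\mathcal{L})\cong S_n$).
   Context: For $e\in E$, the toggle $\tau_e:\mathcal{L}\to\mathcal{L}$ is defined by $\tau_e(X)=X\triangle\{e\}$ if $X\triangle\{e\}\in\mathcal{L}$, and $\tau_e(X)=X$ otherwise. The toggle group $T(\mathcal{L})$ is the subgroup of the symmetric group on $\mathcal{L}$ generated by $\{\tau_e: e\in E\}$; its degree is $|\mathcal{L}|$. *)

(* Defs.v *)
From mathcomp Require Import all_boot all_fingroup.

Set Implicit Arguments.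
Unset Strict Implicit.
Unset Printing Implicit Defensive.

Section Toggle.

Variables (E : finType) (L : {set {set E}}).

Definition symdiff (A B : {set E}) : {set E} := (A :\: B) :|: (B :\: A).

Local Notation member := {X : {set E} | X \in L}.

(* [insubd X Y] is Y viewed in L when Y \in L, and X otherwise. *)
Definition toggle (e : E) (X : member) : member :=
  insubd X (symdiff (val X) [set e]).

Lemma symdiffK (e : E) (A : {set E}) :
  symdiff (symdiff A [set e]) [set e] = A.
Proof.
by apply/setP=> x; rewrite !inE; case: (x == e); case: (x \in A).
Qed.

Lemma toggleK (e : E) : involutive (toggle e).
Proof.
move=> X; apply: val_inj; rewrite /toggle.
have [sL | sNL] := boolP (symdiff (val X) [set e] \in L).
  have vE : val (insubd X (symdiff (val X) [set e])) = symdiff (val X) [set e].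
    by rewrite val_insubd sL.
  by rewrite val_insubd vE symdiffK (valP X).
have -> : insubd X (symdiff (val X) [set e]) = X.
  by apply: val_inj; rewrite val_insubd (negbTE sNL).
by rewrite val_insubd (negbTE sNL).
Qed.

Definition toggle_perm (e : E) : {perm member} := perm (can_inj (toggleK e)).

Definition toggle_group : {group {perm member}} :=
  <<[set toggle_perm e | e : E]>>%G.

End Toggle.

Notation member L := {X : {set _} | X \in L}.

(* Main.v *)
(* Call X and Y linked when the transposition (X Y) lies in the toggle group G;
   the classes of this relation are blocks permuted by G, and G is the full
   symmetric group as soon as there is only one. Suppose there are several.
   A toggle at e that moves some X to another block translates the whole
   block of X by {e}, so all blocks are translates of each other. Call e
   inner if it joins two linked sets; by translation this happens in every
   block or in none. Inner toggles act in the same way on all blocks and the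
   other ones translate blocks, so the actions of a g in G on two translated
   blocks differ by a translation by non-inner elements. Applied to (X Y)
   and an adjacent block, this makes (X Y) a translation on the block of X:
   the block is {X, Y}, and no element is inner. Translation by the
   symmetric difference U of X and Y then exchanges the two points of every
   block and commutes with all toggles. Given e, choose u in U other than e:
   translation by U swaps the sets that contain u with those that do not,
   and the toggle at e preserves both families, so it is even. But (X Y) is
   odd. *)

Require Import Defs.
From mathcomp Require Import all_boot all_fingroup.

Set Implicit Arguments.
Unset Strict Implicit.
Unset Printing Implicit Defensive.

Local Open Scope group_scope.

(** * Symmetric differences *)

Section SymDiff.

Variable E : finType.
Implicit Types (A B C : {set E}) (x : E).

Lemma in_symdiff A B x : (x \in symdiff A B) = (x \in A) (+) (x \in B).
Proof. by rewrite !inE; case: (x \in A); case: (x \in B). Qed.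

Lemma symdiffC A B : symdiff A B = symdiff B A.
Proof. by apply/setP=> x; rewrite !in_symdiff addbC. Qed.

Lemma symdiffA A B C : symdiff A (symdiff B C) = symdiff (symdiff A B) C.
Proof. by apply/setP=> x; rewrite !in_symdiff addbA. Qed.

Lemma symdiffAC A B C : symdiff (symdiff A B) C = symdiff (symdiff A C) B.
Proof. by rewrite -!symdiffA (symdiffC B). Qed.

Lemma symdiffKr A B : symdiff (symdiff A B) B = A.
Proof. by apply/setP=> x; rewrite !in_symdiff addbK. Qed.

Lemma symdiffKl A B : symdiff A (symdiff A B) = B.
Proof. by apply/setP=> x; rewrite !in_symdiff addKb. Qed.

Lemma symdiff0 A : symdiff A set0 = A.
Proof. by apply/setP=> x; rewrite in_symdiff in_set0 addbF. Qed.

Lemma symdiff1_neq x A : symdiff A [set x] != A.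
Proof.
apply/eqP=> /setP/(_ x).
by rewrite in_symdiff in_set1 eqxx; case: (x \in A).
Qed.

End SymDiff.

(* The two halves of [t], on [H] and on its complement, are conjugate under [s]. *)
Lemma odd_perm_swapped_halves (T : finType) (H : {set T}) (s t : {perm T}) :
    (forall x, (s x \in H) = (x \notin H)) ->
    (forall x, (t x \in H) = (x \in H)) ->
    (forall x, t (s x) = s (t x)) ->
  ~~ odd_perm t.
Proof.
move=> sH tH ts.
have nHt : t \in 'N(H | 'P).
  by apply/astabsP=> x; rewrite /= apermE tH.
set u := restr_perm H t.
have uH x : x \in H -> u x = t x by exact: restr_permE.
have uNH x : x \notin H -> u x = x by apply: (out_perm (restr_perm_on H t)).
(* Here [u] is [t] on [H] and the identity elsewhere, so [u ^ s] is [t] off [H]; conjugates have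
   equal sign. *)
suff ->: t = u * u ^ s by rewrite odd_permM odd_permJ addbb.
apply/permP=> x; rewrite permM; set y := s^-1 (u x).
have ->: (u ^ s) (u x) = s (u y) by rewrite -[u x in LHS](permKV s) permJ.
have sy : s y = u x by rewrite /y permKV.
have [xH | xNH] := boolP (x \in H).
  rewrite uNH; first by rewrite sy uH.
  by rewrite -sH sy uH // tH.
have sy' : s y = x by rewrite sy uNH.
by rewrite uH -?ts ?sy' //; move: xNH; rewrite -sy' sH negbK.
Qed.

Lemma tperm_generated (T : finType) (G : {group {perm T}}) :
  (forall x y, tperm x y \in G) -> G = [set: {perm T}] :> {set {perm T}}.
Proof.
move=> tG; apply/setP=> s; rewrite inE.
have [ts -> _] := prod_tpermP s.
by apply: group_prod.
Qed.

Lemma isog_perm_ord (T : finType) (n : nat) :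
  #|T| = n -> [set: {perm T}] \isog [set: 'S_n].
Proof.
move=> <-.
have inj (s : {perm T}) : injective (fun i : 'I_#|T| => enum_rank (s (enum_val i))).
  by move=> i j /enum_rank_inj/perm_inj/enum_val_inj.
pose f s := perm (inj s).
have fM : {in setT &, {morph f : s t / s * t}}.
  by move=> s t _ _; apply/permP=> i; rewrite !(permE, permM) enum_rankK.
apply/isogP; exists (Morphism fM).
  apply/injmP=> s t _ _ /permP eq_f; apply/permP=> x.
  by have:= eq_f (enum_rank x); rewrite !permE enum_rankK => /enum_rank_inj.
rewrite morphimEdom; apply/eqP; rewrite -subTset; apply/subsetP=> s _.
have inj' : injective (fun x => enum_val (s (enum_rank x))).
  by move=> x y /enum_val_inj/perm_inj/enum_rank_inj.
apply/imsetP; exists (perm inj'); first by rewrite inE.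
by apply/permP=> i; rewrite !permE enum_valK enum_valK.
Qed.

Section ToggleBlocks.

Variables (E : finType) (L : {set {set E}}).

Local Notation T := (member L).
Local Notation G := (toggle_group L).
Local Notation tau := (@toggle_perm E L).

Implicit Types (e f : E) (X Y Z W : T) (g : {perm T}) (S U : {set E}).

Lemma val_toggle_perm e X :
  tau e X != X -> val (tau e X) = symdiff (val X) [set e].
Proof.
rewrite -val_eqE /= permE /toggle val_insubd.
by case: ifP => // _; rewrite eqxx.
Qed.

Lemma toggle_perm_eq e X Y :
  val Y = symdiff (val X) [set e] -> tau e X = Y.
Proof.
by move=> YE; apply: val_inj; rewrite permE /toggle val_insubd -YE (valP Y).
Qed.

Lemma toggle_perm_in e : tau e \in G.
Proof. by apply: mem_gen; apply/imsetP; exists e. Qed.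

(** In a finite group, a generated subgroup consists of products of generators, without inverses. *)
Lemma toggle_group_ind (P : {perm T} -> Prop) :
    P 1 -> (forall g e, g \in G -> P g -> P (g * tau e)) ->
  forall g, g \in G -> P g.
Proof.
move=> P1 PM g /gen_prodgP[n [c cG ->]].
elim: n c cG => [|n IHn] c cG; first by rewrite big_ord0.
rewrite big_ord_recr /=; have /imsetP[e _ ->] := cG ord_max.
apply: PM; last by apply: IHn.
apply: group_prod => i _; have /imsetP[e' _ ->] := cG (widen_ord (leqnSn n) i).
exact: toggle_perm_in.
Qed.

(** * Linked sets, inner and outer toggles *)

Definition linked X Y := tperm X Y \in G.

Lemma linked_refl X : linked X X.
Proof. by rewrite /linked tperm1 group1. Qed.

Lemma linked_sym X Y : linked X Y = linked Y X.
Proof. by rewrite /linked tpermC. Qed.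

Lemma linked_act g X Y : g \in G -> linked (g X) (g Y) = linked X Y.
Proof. by move=> gG; rewrite /linked -tpermJ groupJr. Qed.

(** Conjugating [tperm X Y] by [tperm Y Z] gives [tperm X Z]. *)
Lemma linked_trans Y X Z : linked X Y -> linked Y Z -> linked X Z.
Proof.
move=> XY YZ; have [<- | nXZ] := eqVneq X Z; first exact: linked_refl.
have [<- // | nYX] := eqVneq Y X.
rewrite -[X](@tpermD _ Y Z) // 1?eq_sym //.
by rewrite -{2}(tpermL Y Z) linked_act.
Qed.

Lemma linked_toggle e X Y : linked (tau e X) (tau e Y) = linked X Y.
Proof. exact/linked_act/toggle_perm_in. Qed.

Definition inner e X :=
  [exists Z, [&& linked X Z, linked Z (tau e Z) & tau e Z != Z]].

Lemma inner_linked e X Y : linked X Y -> inner e X -> inner e Y.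
Proof.
move=> XY /existsP[Z /and3P[XZ ZeZ nZ]]; apply/existsP; exists Z.
by rewrite ZeZ nZ (linked_trans _ XZ) // linked_sym.
Qed.

(** With [Z] the witness, the chain [X], [Z], [tau e Z], [tau e X] is linked. *)
Lemma inner_stable e X : inner e X -> linked X (tau e X).
Proof.
move=> /existsP[Z /and3P[XZ ZeZ _]]; apply: (linked_trans XZ).
by apply: (linked_trans ZeZ); rewrite linked_toggle linked_sym.
Qed.

Lemma inner_linked_toggle e X : linked X (tau e X) -> tau e X != X -> inner e X.
Proof. by move=> XeX nX; apply/existsP; exists X; rewrite linked_refl XeX. Qed.

(** If [tau e] moved [Y] but fixed [W] in its block, then [Y], [W = tau e W] and [tau e Y] would be
    linked, making [e] inner. *)
Lemma outer_moves_block e X Z :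
  ~~ inner e X -> linked X Z -> (tau e Z != Z) = (tau e X != X).
Proof.
have moves Y W : ~~ inner e Y -> linked Y W -> tau e Y != Y -> tau e W != W.
  move=> nin YW nY; apply: contraNneq nin => eW.
  apply: inner_linked_toggle nY; apply: (linked_trans YW).
  by rewrite -{1}eW linked_toggle linked_sym.
move=> nin XZ; have nin' : ~~ inner e Z.
  by apply: contra nin; apply: inner_linked; rewrite linked_sym.
by apply/idP/idP; apply: moves; rewrite // linked_sym.
Qed.

(** The set by which a toggle that is not inner translates the block of [X]. *)
Definition outer_shift e X : {set E} :=
  if tau e X != X then [set e] else set0.

Lemma notin_outer_shift e f X : e != f -> e \notin outer_shift f X.
Proof. by rewrite /outer_shift; case: ifP => _; rewrite inE. Qed.

Lemma val_outer_toggle e X Z :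
    ~~ inner e X -> linked X Z ->
  val (tau e Z) = symdiff (val Z) (outer_shift e X).
Proof.
move=> nin XZ; rewrite /outer_shift -(outer_moves_block nin XZ).
by case: eqP => [->|/eqP/val_toggle_perm //]; rewrite symdiff0.
Qed.

(** An inner [f] stays in the block; any other [f] translates the whole block, so it carries [Z] and
    [tau e Z] to a pair still joined by [e]. *)
Lemma inner_toggle e f X : inner e X -> inner e (tau f X).
Proof.
have [inf /(inner_linked (inner_stable inf)) // | outf] := boolP (inner f X).
move=> /existsP[Z /and3P[XZ ZeZ nZ]].
have XeZ := linked_trans XZ ZeZ.
have efE : tau e (tau f Z) = tau f (tau e Z).
  apply: toggle_perm_eq; rewrite !(val_outer_toggle outf) //.
  by rewrite val_toggle_perm // symdiffAC.
by apply/existsP; exists (tau f Z); rewrite efE !linked_toggle XZ ZeZ inj_eq //;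
  exact: perm_inj.
Qed.

(** * Translations between blocks *)

Definition translates S X X' :=
  (forall Z, linked X Z ->
     exists2 Z', linked X' Z' & val Z' = symdiff (val Z) S) /\
  (forall Z', linked X' Z' ->
     exists2 Z, linked X Z & val Z' = symdiff (val Z) S).

Hypothesis transL : [transitive G, on [set: T] | 'P].

Lemma toggle_transitive X Y : exists2 g, g \in G & Y = g X.
Proof. by apply: (atransP2 transL); rewrite inE. Qed.

Lemma inner_const e X Y : inner e X -> inner e Y.
Proof.
have [g gG ->] := toggle_transitive X Y; move=> inX.
elim/toggle_group_ind: g / gG => [|g f _ IHg]; first by rewrite perm1.
by rewrite permM; apply: inner_toggle.
Qed.

Lemma outer_const e X Y : ~~ inner e X -> ~~ inner e Y.
Proof. by apply: contra; apply: inner_const. Qed.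

(** An inner [f] acts alike on both blocks, so [S] persists; any other [f] shifts each block
    separately, altering [S] at most at [f]. *)
Lemma translates_toggle f S X X' :
    {in S, forall e, ~~ inner e X} -> translates S X X' ->
  exists2 S' : {set E}, {in S', forall e, ~~ inner e X} &
    forall Z Z', linked X Z -> linked X' Z' -> val Z' = symdiff (val Z) S ->
      val (tau f Z') = symdiff (val (tau f Z)) S'.
Proof.
move=> outS [XX' X'X]; have [inf | outf] := boolP (inner f X).
  have stable Y W : linked Y W -> linked Y (tau f W).
    move/linked_trans; apply; apply: inner_stable; exact: inner_const inf.
  exists S => // Z Z' XZ XZ' Z'E.
  have [fZ | nZ] := eqVneq (tau f Z) Z.
    have [-> | nZ'] := eqVneq (tau f Z') Z'; first by rewrite fZ.
    (* If only [Z'] moved, pulling its image back by [S] would give a member of [L] to which [tau f]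
       sends [Z]. *)
    have [W _ WE] := X'X _ (stable _ _ XZ').
    have WZ : val W = symdiff (val Z) [set f].
      by rewrite -[LHS](symdiffKr _ S) -WE val_toggle_perm // Z'E symdiffAC
                 symdiffKr.
    have := symdiff1_neq f (val Z).
    by rewrite -WZ -(toggle_perm_eq WZ) fZ eqxx.
  have [W' _ W'E] := XX' _ (stable _ _ XZ).
  rewrite (@toggle_perm_eq f Z' W') // W'E val_toggle_perm // Z'E.
  exact: symdiffAC.
exists (symdiff S (symdiff (outer_shift f X) (outer_shift f X'))).
  move=> e; rewrite !in_symdiff.
  have [-> _ // | nef] := eqVneq e f.
  have shF Y : (e \in outer_shift f Y) = false.
    exact/negbTE/notin_outer_shift.
  by rewrite !shF !addbF => /outS.
move=> Z Z' XZ XZ' Z'E.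
rewrite (val_outer_toggle outf XZ) (val_outer_toggle (outer_const _ outf) XZ').
by rewrite Z'E !symdiffA (symdiffAC _ (outer_shift f X) S) symdiffKr.
Qed.

(** After each prefix of a word of toggles the two image blocks are again translates, so the next
    toggle can be treated. *)
Lemma translates_act g S X X' :
    g \in G -> {in S, forall e, ~~ inner e X} -> translates S X X' ->
  exists2 S' : {set E}, {in S', forall e, ~~ inner e X} &
    forall Z Z', linked X Z -> linked X' Z' -> val Z' = symdiff (val Z) S ->
      val (g Z') = symdiff (val (g Z)) S'.
Proof.
move=> gG outS [XX' X'X].
elim/toggle_group_ind: g / gG => [|g f gG [S1 outS1 gE]].
  by exists S => // Z Z' _ _; rewrite !perm1.
have trS1 : translates S1 (g X) (g X').
  split=> W; rewrite -[W](permKV g) linked_act // => XW.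
    have [Z' X'Z' Z'E] := XX' _ XW; exists (g Z'); first by rewrite linked_act.
    exact: gE.
  have [Z XZ ZE] := X'X _ XW; exists (g Z); first by rewrite linked_act.
  exact: gE.
have [|S2 outS2 fE] := translates_toggle f _ trS1.
  by move=> e /outS1; apply: outer_const.
exists S2 => [e /outS2|Z Z' XZ XZ' Z'E]; first exact: outer_const.
by rewrite !permM; apply: fE; rewrite ?linked_act //; apply: gE.
Qed.

(* By [translates_act], [tperm X Y] acts on the block of [X] as on the adjacent
   block, that is trivially, up to a translation. *)
Lemma tperm_block_pair e X Y :
    linked X Y -> X != Y -> ~~ linked X (tau e X) ->
  {in symdiff (val X) (val Y), forall f, ~~ inner f X} /\
  (forall Z, linked X Z -> Z = X \/ Z = Y).
Proof.
move=> XY nXY far; set X' := tau e X.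
have oute : ~~ inner e X by apply: contra far; exact: inner_stable.
have nX : tau e X != X by apply: contraNneq far => ->; exact: linked_refl.
have shE : outer_shift e X = [set e] by rewrite /outer_shift nX.
have tr : translates [set e] X X'.
  split=> Z.
    move=> XZ; exists (tau e Z); first by rewrite linked_toggle.
    by rewrite (val_outer_toggle oute XZ) shE.
  rewrite -[Z](permKV (tau e)) linked_toggle => XZ.
  by exists ((tau e)^-1 Z); rewrite // (val_outer_toggle oute XZ) shE.
have outS : {in [set e], forall f, ~~ inner f X} by move=> f /set1P->.
have [S outS' tE] := translates_act XY outS tr.
(* [tperm X Y] fixes the block of [X'] pointwise and turns the difference [[set e]] into [S], so on
   the block of [X] it must translate by [U]. *)
pose U := symdiff S [set e].
have tU Z : linked X Z -> val (tperm X Y Z) = symdiff (val Z) U.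
  move=> XZ; have XZ' : linked X' (tau e Z) by rewrite linked_toggle.
  have eZE : val (tau e Z) = symdiff (val Z) [set e].
    by rewrite (val_outer_toggle oute XZ) shE.
  have off V : linked X V -> V != tau e Z.
    move=> XV; apply: contraNneq far => VE; apply: (linked_trans XV).
    by rewrite VE linked_sym.
  have tZ : tperm X Y (tau e Z) = tau e Z.
    by apply: tpermD; apply: off => //; exact: linked_refl.
  have := tE _ _ XZ XZ' eZE; rewrite tZ eZE.
  move=> ZE; rewrite -[LHS](symdiffKr _ S) -ZE /U -symdiffA; congr symdiff.
  exact: symdiffC.
have YE : val Y = symdiff (val X) U by rewrite -tU ?tpermL ?linked_refl.
split=> [f|Z XZ].
  rewrite YE symdiffKl in_symdiff inE.
  by case: (boolP (f \in S)) => [/outS' // | _ /eqP->].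
have [-> | nZX] := eqVneq Z X; first by left.
have [-> | nZY] := eqVneq Z Y; first by right.
(* A third point [Z] is fixed, which forces [U] to be empty and [X = Y]. *)
have := tU Z XZ; rewrite tpermD 1?eq_sym // => ZE.
have U0 : U = set0.
  rewrite -[U](symdiffKl (val Z)) -ZE; apply/setP=> x.
  by rewrite in_symdiff inE addbb.
by case/eqP: nXY; apply: val_inj; rewrite YE U0 symdiff0.
Qed.

Lemma linked_all X Y Z W : linked X Y -> X != Y -> linked Z W.
Proof.
move=> XY nXY.
have [/forallP close | /forallPn[X1 /forallPn[e far]]] :=
    boolP [forall X1, forall e, linked X1 (tau e X1)].
  have [g gG ->] := toggle_transitive Z W.
  elim/toggle_group_ind: g / gG => [|g e _ Zg].
    by rewrite perm1 linked_refl.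
  by rewrite permM; apply: (linked_trans Zg); apply/forallP: e; apply: close.
have [g gG X1E] := toggle_transitive X X1.
pose Y1 := g Y.
have XY1 : linked X1 Y1 by rewrite X1E linked_act.
have nXY1 : X1 != Y1 by rewrite X1E (inj_eq perm_inj).
have [outU pair] := tperm_block_pair XY1 nXY1 far.
set U := symdiff (val X1) (val Y1) in outU.
have Y1E : val Y1 = symdiff (val X1) U by rewrite symdiffKl.
have out f V : ~~ inner f V.
  apply: (outer_const (X := X1)); apply/negP=> inf.
  case/existsP: (inf) => V1 /and3P[X1V V1f nV1].
  (* In a block with only the points [X1] and [Y1], an inner [f] would have to join these two. *)
  suff Uf : U = [set f] by have := outU f; rewrite inf Uf inE eqxx => /(_ isT).
  have [V1E|V1E] := pair _ X1V; have [fE|fE] := pair _ (linked_trans X1V V1f).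
  - by rewrite fE V1E eqxx in nV1.
  - by rewrite /U -fE val_toggle_perm // V1E symdiffKl.
  - by rewrite /U -V1E symdiffC -fE val_toggle_perm // symdiffKl.
  - by rewrite fE V1E eqxx in nV1.
(* As no toggle is inner, each translates blocks, so the pair [X1], [Y1] is carried everywhere with
   its difference [U]. *)
have partner V : exists2 V', linked V V' & val V' = symdiff (val V) U.
  have [h hG ->] := toggle_transitive X1 V.
  elim/toggle_group_ind: h / hG => [|h f _ [V' hV' V'E]].
    by rewrite perm1; exists Y1.
  rewrite permM; exists (tau f V'); first by rewrite linked_toggle.
  rewrite !(val_outer_toggle (out f (h X1))) ?linked_refl // V'E.
  exact: symdiffAC.
(* By [partner] the translate lies in [L], so [insubd] returns it and not its default. *)
pose sigma V : T := insubd V (symdiff (val V) U).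
have sigmaE V : val (sigma V) = symdiff (val V) U.
  by have [V' _ V'E] := partner V; rewrite val_insubd -V'E (valP V').
have sigmaP V : linked V (sigma V).
  by have [V' VV' /esym] := partner V; rewrite -sigmaE => /val_inj->.
have sigmaI : injective sigma.
  move=> V V' /(congr1 val); rewrite !sigmaE => eqV; apply: val_inj.
  by rewrite -[LHS](symdiffKr _ U) eqV symdiffKr.
have even f : ~~ odd_perm (tau f).
  (* [U] is nonempty, and [U = [set f]] would make [f] join [X1] to [Y1], hence inner. *)
  have [u Uu nuf] : exists2 u, u \in U & u != f.
    case: (pickP [pred u in U | u != f]) => [u /andP[Uu nuf] | noU].
      by exists u.
    have sub_f u : u \in U -> u = f.
      by move=> Uu; have /= := noU u; rewrite Uu => /negbFE/eqP.
    have [u Uu] : exists u, u \in U.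
      apply/set0Pn; apply: contra nXY1 => /eqP U0.
      by rewrite -val_eqE /= Y1E U0 symdiff0.
    have UE : U = [set f].
      apply/eqP; rewrite eqEsubset; apply/andP; split; apply/subsetP=> v.
        by move/sub_f->; rewrite inE.
      by move/set1P->; rewrite -(sub_f u Uu).
    rewrite UE in Y1E; case/negP: (out f X1).
    by apply: inner_linked_toggle; rewrite (toggle_perm_eq Y1E) // eq_sym.
  apply: (@odd_perm_swapped_halves _ [set V : T | u \in val V] (perm sigmaI)).
  - by move=> V; rewrite permE !inE sigmaE in_symdiff Uu addbT.
  - move=> V; rewrite !inE (val_outer_toggle (out f V) (linked_refl V)).
    by rewrite in_symdiff (negbTE (notin_outer_shift _ nuf)) addbF.
  move=> V; apply: val_inj; rewrite ![perm sigmaI _]permE sigmaE.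
  rewrite (val_outer_toggle (out f V) (sigmaP V)) sigmaE.
  rewrite (val_outer_toggle (out f V) (linked_refl V)); exact: symdiffAC.
have evenG h : h \in G -> ~~ odd_perm h.
  move=> hG; elim/toggle_group_ind: h / hG => [|h f _ evh].
    by rewrite odd_perm1.
  by rewrite odd_permM (negbTE evh) (negbTE (even f)).
by have := evenG _ XY1; rewrite odd_tperm nXY1.
Qed.

End ToggleBlocks.

Theorem theorem3p1 (E : finType) (L : {set {set E}}) (n : nat)
    (cardL : #|L| = n)
    (transL : [transitive toggle_group L, on [set: member L] | 'P])
    (transp : exists X Y : member L,
       X <> Y /\ (tperm X Y \in toggle_group L)) :
  (toggle_group L = [set: {perm member L}] :> {set {perm member L}}) /\
  (toggle_group L \isog [set: 'S_n]).
Proof.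
have [X [Y [/eqP nXY XY]]] := transp.
have GT : toggle_group L = [set: {perm member L}] :> {set {perm member L}}.
  by apply: tperm_generated => Z W; apply: linked_all XY nXY.
split=> //; rewrite GT; apply: isog_perm_ord.
by rewrite card_sig -cardL; apply: eq_card.
Qed.
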